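(* Let $\mathcal{M}$ be an $N$-manifold with underlying degree $0$ manifold $M$, let $\mathcal{B}\to\mathcal{M}$ be a degree-bounded vector bundle in the category of graded manifolds, and let $\mathcal{E}=0_{\mathcal{M}}^*\mathcal{B}\to M$ be the standard graded vector bundle associated to $\mathcal{B}$. Let $\Theta:\mathcal{B}\to\pi_{\mathcal{M}}^*\mathcal{E}$ be an isomorphism of vector bundles over $\mathcal{M}$. Then $\Theta$ is filtration-preserving (in the sense defined in the context) if and only if $\Theta\circ\tilde{0}_{\mathcal{B}}=\tilde{0}_{\pi_{\mathcal{M}}^*\mathcal{E}}$, where $\tilde{0}_{\mathcal{B}}:\mathcal{E}=0_{\mathcal{M}}^*\mathcal{B}\to\mathcal{B}$ and $\tilde{0}_{\pi_{\mathcal{M}}^*\mathcal{E}}:\mathcal{E}=0_{\mathcal{M}}^*\pi_{\mathcal{M}}^*\mathcal{E}\to\pi_{\mathcal{M}}^*\mathcal{E}$ are the natural maps associated to pullback bundles (equivalently, if and only if the induced map $0_{\mathcal{M}}^*\Theta:\mathcal{E}\to 0_{\mathcal{M}}^*\pi_{\mathcal{M}}^*\mathcal{E}=\mathcal{E}$ is the identity).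
   Context: An $N$-manifold $\mathcal{M}$ is a $\mathbb{Z}$-graded manifold whose local coordinates all have nonnegative degree; the parity of a function agrees with its degree. Its degree $0$ functions are identified with $C^\infty(M)$ for an ordinary smooth manifold $M$. The projection $\pi_{\mathcal{M}}:\mathcal{M}\to M$ is the map whose pullback identifies $C^\infty(M)$ with the degree $0$ functions on $\mathcal{M}$. The zero embedding $0_{\mathcal{M}}:M\to\mathcal{M}$ is the map whose pullback annihilates the ideal of functions generated by those of positive degree. Since $\pi_{\mathcal{M}}\circ 0_{\mathcal{M}}=\mathrm{id}_M$, one has canonically $0_{\mathcal{M}}^*\pi_{\mathcal{M}}^*\mathcal{E}=\mathcal{E}$. A vector bundle $\mathcal{B}\to\mathcal{M}$ is given by its sheaf of sections $\Gamma(\mathcal{B})$, a locally free $\mathbb{Z}$-graded $C^\infty(\mathcal{M})$-module; $\mathrm{rk}_i(\mathcal{B})$ denotes its (finite) rank in degree $i$. $\mathcal{B}$ is degree-bounded if there are integers $m,n$ with $\mathrm{rk}_i(\mathcal{B})=0$ for $i<m$ and for $i>n$. Isomorphisms of vector bundles over $\mathcal{M}$ are degree-preserving, $C^\infty(\mathcal{M})$-linear, and cover the identity of $\mathcal{M}$. The pullback $0_{\mathcal{M}}^*\mathcal{B}$ splits canonically as $\mathcal{E}=\bigoplus_i E_i[-i]$, where the $E_i$ are ordinary vector bundles over $M$ and $\Gamma(E_i[-i])$ is $\Gamma(E_i)$ placed in degree $i$; $\mathcal{E}$ is the standard graded vector bundle associated to $\mathcal{B}$. The bundle $\pi_{\mathcal{M}}^*\mathcal{E}$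 has sections $C^\infty(\mathcal{M})\otimes_{C^\infty(M)}\Gamma(\mathcal{E})$. Filtration: $\mathcal{F}_i(\mathcal{B})$ is the $C^\infty(\mathcal{M})$-submodule of $\Gamma(\mathcal{B})$ generated by sections of degree $\leq i$, and similarly for $\pi_{\mathcal{M}}^*\mathcal{E}$ (whose associated standard graded vector bundle is again $\mathcal{E}$). There is a natural isomorphism $\mathcal{F}_i(\mathcal{B})/\mathcal{F}_{i-1}(\mathcal{B})\cong C^\infty(\mathcal{M})\otimes_{C^\infty(M)}\Gamma(E_i[-i])=\Gamma(\pi_{\mathcal{M}}^*E_i[-i])$, sending the class of a degree $i$ section $\beta$ to $1\otimes 0_{\mathcal{M}}^*\beta$; likewise for $\pi_{\mathcal{M}}^*\mathcal{E}$. An isomorphism $\Theta:\mathcal{B}\to\pi_{\mathcal{M}}^*\mathcal{E}$ is called filtration-preserving if it maps $\mathcal{F}_i(\mathcal{B})$ onto $\mathcal{F}_i(\pi_{\mathcal{M}}^*\mathcal{E})$ for every $i$ and the induced maps $\mathcal{F}_i(\mathcal{B})/\mathcal{F}_{i-1}(\mathcal{B})\to\mathcal{F}_i(\pi_{\mathcal{M}}^*\mathcal{E})/\mathcal{F}_{i-1}(\pi_{\mathcal{M}}^*\mathcal{E})$ are the identity of $\Gamma(\pi_{\mathcal{M}}^*E_i[-i])$ under the natural isomorphisms above. Equivalently, $\Theta$ is one of the isomorphisms obtained by choosing splittings of the short exact sequences $\mathcal{F}_{i-1}(\mathcal{B})\to\mathcal{F}_i(\mathcal{B})\to\Gamma(\pi_{\mathcal{M}}^*E_i[-i])$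 for all $i$. *)

(* Defs.v *)
From HB Require Import structures.
From mathcomp Require Import all_boot all_order all_algebra.
From mathcomp Require Import boolp classical_sets functions cardinality reals.
From mathcomp Require Import topology normedtype derive.

Set Implicit Arguments.
Unset Strict Implicit.
Unset Printing Implicit Defensive.

Import Order.TTheory GRing.Theory Num.Theory.
Import numFieldNormedType.Exports.

Local Open Scope classical_set_scope.
Local Open Scope ring_scope.

(** * Smooth functions and smooth manifolds *)

(* [D] is meant to be open: [f] is C^k on [D] when its iterated partial
   derivatives up to order [k] exist and are continuous at all points of [D]. *)
Fixpoint Ck (R : realType) (n k : nat) (D : set 'rV[R]_n) (f : 'rV[R]_n -> R)
    {struct k} : Prop :=
  (forall x, D x -> {for x, continuous f}) /\
  (if k is k'.+1 then
     forall i : 'I_n, (forall x, D x -> derivable f x 'e_i) /\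
                      Ck k' D (fun x => 'D_('e_i) f x)
   else True).

Definition Cinfty (R : realType) (n : nat) (D : set 'rV[R]_n)
    (f : 'rV[R]_n -> R) : Prop := forall k, Ck k D f.

Record chart (R : realType) (n : nat) (M : topologicalType) := Chart {
  chart_dom : set M;
  chart_map : M -> 'rV[R]_n;
  chart_inv : 'rV[R]_n -> M;
  chart_dom_open : open chart_dom;
  chart_img_open : open (chart_map @` chart_dom);
  chart_mapK : forall x, chart_dom x -> chart_inv (chart_map x) = x;
  chart_map_cont : forall x, chart_dom x -> {for x, continuous chart_map};
  chart_inv_cont : forall y, (chart_map @` chart_dom) y ->
                             {for y, continuous chart_inv} }.

Record smooth_manifold (R : realType) (n : nat) := SmoothManifold {
  points :> topologicalType;
  points_hausdorff : hausdorff_space points;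
  points_second_countable : @second_countable points;
  atlas : set (chart R n points);
  atlas_cover : forall x : points, exists2 c, atlas c & chart_dom c x;
  atlas_compat : forall c c', atlas c -> atlas c' -> forall i : 'I_n,
    Cinfty (chart_map c @` (chart_dom c `&` chart_dom c'))
           (fun y => chart_map c' (chart_inv c y) ord0 i) }.

Definition smooth_on (R : realType) (n : nat) (M : smooth_manifold R n)
    (U : set M) (f : M -> R) : Prop :=
  forall c, atlas c ->
    Cinfty (chart_map c @` (U `&` chart_dom c)) (fun y => f (chart_inv c y)).

(** * Sheaves of graded rings and of graded modules *)

Record opn (M : topologicalType) := Opn {
  oset :> set M;
  oset_open : open oset }.

Definition locally (M : topologicalType) (U : opn M) (Q : opn M -> Prop) : Prop :=
  forall x, oset U x -> exists V : opn M, [/\ oset V x, V `<=` U & Q V].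

(* Restrictions [res U V] are total, but only meaningful when [V `<=` U].
   Sections over [U] are finite sums of homogeneous sections, so the gluing
   axiom is imposed degree by degree. *)
Record graded_sheaf (M : topologicalType) (S : opn M -> zmodType)
    (res : forall U V : opn M, S U -> S V)
    (deg : forall U : opn M, int -> set (S U)) : Prop := GradedSheaf {
  gs_resD : forall U V : opn M, V `<=` U ->
    forall s t, res U V (s + t) = res U V s + res U V t;
  gs_res_id : forall (U : opn M) s, res U U s = s;
  gs_res_comp : forall U V W : opn M, V `<=` U -> W `<=` V ->
    forall s, res V W (res U V s) = res U W s;
  gs_deg0 : forall U k, deg U k 0;
  gs_degB : forall U k s t, deg U k s -> deg U k t -> deg U k (s - t);
  gs_deg_res : forall U V : opn M, V `<=` U ->
    forall k s, deg U k s -> deg V k (res U V s);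
  gs_deg_sum : forall U (s : S U), exists (ks : seq int) (c : int -> S U),
    (forall k, deg U k (c k)) /\ s = \sum_(k <- ks) c k;
  gs_deg_direct : forall U (ks : seq int) (c : int -> S U), uniq ks ->
    (forall k, deg U k (c k)) -> \sum_(k <- ks) c k = 0 ->
    forall k, k \in ks -> c k = 0;
  gs_separated : forall (U : opn M) (s : S U),
    locally U (fun V => res U V s = 0) -> s = 0;
  gs_glue : forall (U : opn M) (k : int) (I : Type) (V : I -> opn M)
      (c : forall i, S (V i)),
    (U : set M) = \bigcup_i (V i : set M) ->
    (forall i, deg (V i) k (c i)) ->
    (forall i j (W : opn M), W `<=` V i -> W `<=` V j ->
       res (V i) W (c i) = res (V j) W (c j)) ->
    exists s, deg U k s /\ forall i, res U (V i) s = c i }.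

Record ring_sheaf (M : topologicalType) := RingSheaf {
  rsec :> opn M -> pzRingType;
  rres : forall U V, rsec U -> rsec V;
  rdeg : forall U, int -> set (rsec U);
  rsheaf : @graded_sheaf M (fun U => rsec U : zmodType) rres rdeg;
  rres1 : forall U V : opn M, V `<=` U -> rres V (1 : rsec U) = 1;
  rresM : forall U V : opn M, V `<=` U ->
    forall a b : rsec U, rres V (a * b) = rres V a * rres V b;
  rdeg1 : forall U, rdeg 0 (1 : rsec U);
  rdegM : forall U i j (a b : rsec U),
    rdeg i a -> rdeg j b -> rdeg (i + j) (a * b);
  rcomm : forall U i j (a b : rsec U), rdeg i a -> rdeg j b ->
    a * b = (-1) ^+ (`|i| * `|j|)%N * (b * a) }.

Record module_sheaf (M : topologicalType) (A : ring_sheaf M) := ModuleSheaf {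
  msec :> forall U : opn M, lmodType (A U);
  mres : forall U V, msec U -> msec V;
  mdeg : forall U, int -> set (msec U);
  msheaf : @graded_sheaf M (fun U => msec U : zmodType) mres mdeg;
  mresZ : forall U V : opn M, V `<=` U ->
    forall (a : A U) (s : msec U), mres V (a *: s) = rres V a *: mres V s;
  mdegZ : forall U i j (a : A U) (s : msec U),
    rdeg i a -> mdeg j s -> mdeg (i + j) (a *: s) }.

Record ring_sheaf_map (M : topologicalType) (A A' : ring_sheaf M) :=
    RingSheafMap {
  rmap :> forall U, A U -> A' U;
  rmapD : forall U (a b : A U), rmap (a + b) = rmap a + rmap b;
  rmap1 : forall U, rmap (1 : A U) = 1;
  rmapM : forall U (a b : A U), rmap (a * b) = rmap a * rmap b;
  rmap_res : forall U V : opn M, V `<=` U ->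
    forall a : A U, rmap (rres V a) = rres V (rmap a);
  rmap_deg : forall U k (a : A U), rdeg k a -> rdeg k (rmap a) }.

Definition ring_sheaf_id (M : topologicalType) (A : ring_sheaf M) :
  ring_sheaf_map A A := @RingSheafMap M A A (fun U a => a)
    (fun _ _ _ => erefl) (fun _ => erefl) (fun _ _ _ => erefl)
    (fun _ _ _ _ => erefl) (fun _ _ _ h => h).

(* Degree-preserving maps of sheaves that are semilinear over [f]. *)
Record semilinear_map (M : topologicalType) (A A' : ring_sheaf M)
    (f : ring_sheaf_map A A') (P : module_sheaf A) (P' : module_sheaf A') :=
    SemilinearMap {
  smap :> forall U, P U -> P' U;
  smapD : forall U (s t : P U), smap (s + t) = smap s + smap t;
  smapZ : forall U (a : A U) (s : P U), smap (a *: s) = f U a *: smap s;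
  smap_res : forall U V : opn M, V `<=` U ->
    forall s : P U, smap (mres V s) = mres V (smap s);
  smap_deg : forall U k (s : P U), mdeg k s -> mdeg k (smap s) }.

Definition linear_map (M : topologicalType) (A : ring_sheaf M)
    (P Q : module_sheaf A) := semilinear_map (ring_sheaf_id A) P Q.

Definition linear_id (M : topologicalType) (A : ring_sheaf M)
    (P : module_sheaf A) : linear_map P P :=
  @SemilinearMap M A A (ring_sheaf_id A) P P (fun U s => s)
    (fun _ _ _ => erefl) (fun _ _ _ => erefl)
    (fun _ _ _ _ => erefl) (fun _ _ _ h => h).

Definition is_isomorphism (M : topologicalType) (A : ring_sheaf M)
    (P Q : module_sheaf A) (T : linear_map P Q) : Prop :=
  forall U, bijective (@smap M A A (ring_sheaf_id A) P Q T U).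

(** * Pullbacks *)

(* The element [\sum_k a k (x) x k] of the tensor product [S' (x)_S N], where
   [S'] is an [S]-module through [f], is zero. *)
Definition tensor_zero (S S' : pzRingType) (f : S -> S') (N : lmodType S)
    (n : nat) (a : 'I_n -> S') (x : 'I_n -> N) : Prop :=
  forall (G : zmodType) (b : S' -> N -> G),
    (forall c d y, b (c + d) y = b c y + b d y) ->
    (forall c y z, b c (y + z) = b c y + b c z) ->
    (forall c s y, b (c * f s) y = b c (s *: y)) ->
    \sum_(k < n) b (a k) (x k) = 0.

(* [u : P -> P'] exhibits [P'] as the pullback of [P] along a map of graded
   spaces which is the identity on points and has comorphism [f], i.e. as the
   sheaf associated with [V |-> A' V (x)_(A V) P V], with [u s = 1 (x) s]. *)
Record is_pullback (M : topologicalType) (A A' : ring_sheaf M)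
    (f : ring_sheaf_map A A') (P : module_sheaf A) (P' : module_sheaf A')
    (u : semilinear_map f P P') : Prop := IsPullback {
  pb_generated : forall (U : opn M) (s : P' U), locally U (fun V =>
    exists (n : nat) (a : 'I_n -> A' V) (x : 'I_n -> P V),
      mres V s = \sum_(k < n) a k *: u V (x k));
  pb_relations : forall (U : opn M) (n : nat) (a : 'I_n -> A' U) (x : 'I_n -> P U),
    \sum_(k < n) a k *: u U (x k) = 0 -> locally U (fun V =>
      tensor_zero (f V) (fun k => rres V (a k)) (fun k => mres V (x k))) }.

(** * N-manifolds *)

(* The structure sheaf of a smooth manifold, as a graded ring sheaf
   concentrated in degree 0; [value] identifies its sections over [U] with the
   smooth functions on [U] (the values off [U] are irrelevant). *)
Record smooth_sheaf (R : realType) (n : nat) (M : smooth_manifold R n) :=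
    SmoothSheaf {
  Csheaf :> ring_sheaf M;
  value : forall U, Csheaf U -> M -> R;
  valueD : forall U (a b : Csheaf U) x, oset U x ->
    value (a + b) x = value a x + value b x;
  value1 : forall U x, oset U x -> value (1 : Csheaf U) x = 1;
  valueM : forall U (a b : Csheaf U) x, oset U x ->
    value (a * b) x = value a x * value b x;
  value_res : forall U V : opn M, V `<=` U -> forall (a : Csheaf U) x,
    oset V x -> value (rres V a) x = value a x;
  value_smooth : forall U (a : Csheaf U), smooth_on U (value a);
  value_inj : forall U (a : Csheaf U),
    (forall x, oset U x -> value a x = 0) -> a = 0;
  value_surj : forall (U : opn M) (g : M -> R), smooth_on U g ->
    exists a : Csheaf U, forall x, oset U x -> value a x = g x;
  Csheaf_deg0 : forall U (a : Csheaf U), rdeg 0 a }.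

(* Labels of coordinates of positive degree, [p d] being the number of
   coordinates of degree [d]: the label [Tagged _ j] with tag [d] stands for a
   coordinate of degree [d.+1]. *)
Definition coord (p : nat -> nat) := {d : nat & 'I_(p d.+1)}.

Definition coord_deg (p : nat -> nat) (x : coord p) : nat := (tag x).+1.

(* Monomials in the coordinates: weakly increasing words (for the lexicographic
   order) in which the coordinates of odd degree are not repeated. *)
Definition monomial (p : nat -> nat) (w : seq (coord p)) : bool :=
  sorted (fun x y : coord p => (x < y)%O || (x == y) && ~~ odd (coord_deg x)) w.

(* [xi] is a system of coordinates of positive degree over [U]: for every
   open [V] in [U], [A V] is the free graded commutative algebra over
   [O V] on the restrictions of [xi]. *)
Definition positive_coordinates (M : topologicalType) (O A : ring_sheaf M)
    (pi : ring_sheaf_map O A) (p : nat -> nat) (U : opn M)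
    (xi : coord p -> A U) : Prop :=
  (forall x, rdeg ((coord_deg x)%:Z) (xi x)) /\
  forall V : opn M, V `<=` U ->
    let mon (w : seq (coord p)) : A V := \prod_(x <- w) rres V (xi x) in
    (forall a : A V, exists (ws : seq (seq (coord p))) (g : seq (coord p) -> O V),
       all (@monomial p) ws /\ a = \sum_(w <- ws) pi V (g w) * mon w) /\
    (forall (ws : seq (seq (coord p))) (g : seq (coord p) -> O V),
       uniq ws -> all (@monomial p) ws ->
       \sum_(w <- ws) pi V (g w) * mon w = 0 ->
       forall w, w \in ws -> g w = 0).

(* [gdim d] is the number of local coordinates of degree [d]; in particular
   the underlying manifold has dimension [gdim 0]. [proj_pb] and [zero_pb] are
   the comorphisms of the projection and of the zero embedding. *)
Record Nmanifold (R : realType) := NManifold {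
  gdim : nat -> nat;
  body :> smooth_manifold R (gdim 0);
  body_sheaf : smooth_sheaf body;
  fsheaf : ring_sheaf body;
  proj_pb : ring_sheaf_map body_sheaf fsheaf;
  proj_pb_deg0 : forall U (a : fsheaf U), rdeg 0 a ->
    exists g : body_sheaf U, a = proj_pb U g;
  zero_pb : ring_sheaf_map fsheaf body_sheaf;
  zero_pb_pos : forall U (k : int) (a : fsheaf U),
    0 < k -> rdeg k a -> zero_pb U a = 0;
  zero_pbK : forall U (g : body_sheaf U), zero_pb U (proj_pb U g) = g;
  local_coordinates : forall x : body, exists (U : opn body)
    (xi : coord gdim -> fsheaf U),
    oset U x /\ positive_coordinates proj_pb xi }.

(** * Vector bundles *)

Definition frame_label (rk : int -> nat) := {i : int & 'I_(rk i)}.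

Definition is_frame (M : topologicalType) (A : ring_sheaf M)
    (P : module_sheaf A) (rk : int -> nat) (U : opn M)
    (e : frame_label rk -> P U) : Prop :=
  (forall j, mdeg (tag j) (e j)) /\
  forall V : opn M, V `<=` U ->
    (forall s : P V, exists (js : seq (frame_label rk)) (a : frame_label rk -> A V),
       s = \sum_(j <- js) a j *: mres V (e j)) /\
    (forall (js : seq (frame_label rk)) (a : frame_label rk -> A V),
       uniq js -> \sum_(j <- js) a j *: mres V (e j) = 0 ->
       forall j, j \in js -> a j = 0).

Record vector_bundle (R : realType) (N : Nmanifold R) := VectorBundle {
  sections :> module_sheaf (fsheaf N);
  rank : int -> nat;
  locally_free : forall x : N, exists (U : opn N)
    (e : frame_label rank -> sections U), oset U x /\ is_frame e }.

Definition degree_bounded (R : realType) (N : Nmanifold R)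
    (B : vector_bundle N) : Prop :=
  exists m n : int, forall i : int, i < m \/ n < i -> rank B i = 0%N.

(** * The filtration *)

Definition span (S : pzRingType) (N : lmodType S) (X : set N) : set N :=
  [set s | exists (n : nat) (a : 'I_n -> S) (x : 'I_n -> N),
     (forall k, X (x k)) /\ s = \sum_(k < n) a k *: x k].

(* The submodule sheaf generated by sections of degree at most [i]. *)
Definition filtration (M : topologicalType) (A : ring_sheaf M)
    (P : module_sheaf A) (i : int) (U : opn M) : set (P U) :=
  [set s | locally U (fun V =>
     span [set t : P V | exists2 j : int, j <= i & mdeg j t] (mres V s))].

(* The summand [pi^* E_i[-i]] of [pi^* E]: the submodule sheaf generated by the
   pullbacks of sections of degree [i] of [E]. *)
Definition pullback_summand (M : topologicalType) (O A : ring_sheaf M)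
    (f : ring_sheaf_map O A) (E : module_sheaf O) (PE : module_sheaf A)
    (eta : semilinear_map f E PE) (i : int) (U : opn M) : set (PE U) :=
  [set q | locally U (fun V => span (eta V @` [set e | mdeg i e]) (mres V q))].

(* The isomorphism of sheaves from [F_i P / F_(i-1) P] to [pi^* E_i[-i]] sending
   the class of a section [b] of degree [i] to [1 (x) 0^* b], viewed as a map
   on [F_i P] with kernel [F_(i-1) P]; [z] is the pullback of sections along
   the zero embedding. Values of [sigma] outside of [F_i P] are irrelevant. *)
Record is_graded_piece_iso (M : topologicalType) (O A : ring_sheaf M)
    (pi : ring_sheaf_map O A) (zero : ring_sheaf_map A O)
    (P : module_sheaf A) (E : module_sheaf O) (PE : module_sheaf A)
    (z : semilinear_map zero P E) (eta : semilinear_map pi E PE) (i : int)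
    (sigma : forall U, P U -> PE U) : Prop := IsGradedPieceIso {
  gp_add : forall U (s t : P U), filtration i s -> filtration i t ->
    sigma U (s + t) = sigma U s + sigma U t;
  gp_scale : forall U (a : A U) (s : P U), filtration i s ->
    sigma U (a *: s) = a *: sigma U s;
  gp_res : forall U V : opn M, V `<=` U -> forall s : P U, filtration i s ->
    sigma V (mres V s) = mres V (sigma U s);
  gp_codomain : forall U (s : P U), filtration i s ->
    pullback_summand eta i (sigma U s);
  gp_kernel : forall U (s : P U), filtration i s ->
    (sigma U s = 0 <-> filtration (i - 1) s);
  gp_surj : forall (U : opn M) (q : PE U), pullback_summand eta i q ->
    locally U (fun V => exists2 s : P V, filtration i s & sigma V s = mres V q);
  gp_class : forall U (b : P U), mdeg i b -> sigma U b = eta U (z U b) }.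

(* The isomorphisms [sigma] and [sigma'] are uniquely determined on
   [F_i P] and [F_i (pi^* E)] by [is_graded_piece_iso]. *)
Definition filtration_preserving (M : topologicalType) (O A : ring_sheaf M)
    (pi : ring_sheaf_map O A) (zero : ring_sheaf_map A O)
    (P : module_sheaf A) (E : module_sheaf O) (PE : module_sheaf A)
    (z : semilinear_map zero P E) (eta : semilinear_map pi E PE)
    (zPE : semilinear_map zero PE E) (Theta : linear_map P PE) : Prop :=
  forall i : int,
    (forall U, Theta U @` filtration i (U := U) = filtration i (U := U)) /\
    exists (sigma : forall U, P U -> PE U) (sigma' : forall U, PE U -> PE U),
      [/\ is_graded_piece_iso z eta i sigma,
          is_graded_piece_iso zPE eta i sigma' &
          forall U (s : P U), filtration i s ->
            sigma' U (Theta U s) = sigma U s].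

(** * Bundle maps covering the zero embedding *)

(* Functions linear on the fibres of a bundle, over the open set [V]. *)
Definition fibre_linear (M : topologicalType) (A : ring_sheaf M)
    (P : module_sheaf A) (V : opn M) (xi : forall W, P W -> A W) : Prop :=
  [/\ forall W : opn M, W `<=` V -> forall s t : P W,
        xi W (s + t) = xi W s + xi W t,
      forall W : opn M, W `<=` V -> forall (a : A W) (s : P W),
        xi W (a *: s) = a * xi W s &
      forall W W' : opn M, W `<=` V -> W' `<=` W -> forall s : P W,
        xi W' (mres W' s) = rres W' (xi W s)].

(* [lambda] is the pullback of the fibre-linear function [xi] on [P] by the
   natural bundle map [E = 0^* P -> P], where [z] is the pullback of sections. *)
Definition natural_map_pullback (M : topologicalType) (O A : ring_sheaf M)
    (zero : ring_sheaf_map A O) (P : module_sheaf A) (E : module_sheaf O)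
    (z : semilinear_map zero P E) (V : opn M)
    (xi : forall W, P W -> A W) (lambda : forall W, E W -> O W) : Prop :=
  fibre_linear V lambda /\
  forall W : opn M, W `<=` V -> forall s : P W,
    lambda W (z W s) = zero W (xi W s).

(* Equality of [Theta \o 0~_P] and [0~_Q] as bundle maps from [E] to [Q] over
   the zero embedding. A bundle map over a given base map is determined by its
   pullback on fibre-linear functions, and [Theta] pulls [xi] back to
   [xi \o Theta]. *)
Definition eq_natural_maps (M : topologicalType) (O A : ring_sheaf M)
    (zero : ring_sheaf_map A O) (P Q : module_sheaf A) (E : module_sheaf O)
    (zP : semilinear_map zero P E) (zQ : semilinear_map zero Q E)
    (Theta : linear_map P Q) : Prop :=
  forall (V : opn M) (xi : forall W, Q W -> A W), fibre_linear V xi ->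
  forall lambda : forall W, E W -> O W,
    natural_map_pullback zP V (fun W s => xi W (Theta W s)) lambda <->
    natural_map_pullback zQ V xi lambda.

(* [T] is the map [0^* Theta : 0^* P -> 0^* Q] induced by [Theta] on pullbacks. *)
Definition is_induced_map (M : topologicalType) (O A : ring_sheaf M)
    (zero : ring_sheaf_map A O) (P Q : module_sheaf A) (E E' : module_sheaf O)
    (zP : semilinear_map zero P E) (zQ : semilinear_map zero Q E')
    (Theta : linear_map P Q) (T : linear_map E E') : Prop :=
  forall U (s : P U), T U (zP U s) = zQ U (Theta U s).

(* Main.v *)
(* Both conditions on [Theta] amount to [zPE \o Theta = zB].
   A section of degree [i] has class [eta (z b)] in the [i]-th graded piece, so
   a filtration-preserving [Theta] satisfies this equation after applying [eta],
   hence before. Conversely, the identification of the [i]-th graded piece of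
   [pi^* E] is the pullback of the projection of [E] onto [E_i]; the equation
   makes its composite with [Theta] the identification for [B].
   For the bundle maps, every fibre-linear [xi] on [pi^* E] has the pullback
   [e |-> zero (xi (eta e))] along the zero embedding, and the [xi] given by the
   coordinates in a local frame of [B] separate the sections of [E]. *)
Require Import Defs.
From mathcomp Require Import all_boot all_order all_algebra.
From mathcomp Require Import boolp classical_sets functions cardinality reals.
From mathcomp Require Import topology normedtype derive.

Set Implicit Arguments.
Unset Strict Implicit.
Unset Printing Implicit Defensive.

Import Order.TTheory GRing.Theory Num.Theory.

Local Open Scope classical_set_scope.
Local Open Scope ring_scope.

(** * Additive maps and direct sum decompositions *)

Section MorphAdd.
Variables (S T : zmodType) (f : S -> T).
Hypothesis fD : {morph f : x y / x + y}.

Lemma morphD_0 : f 0 = 0.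
Proof. by apply: (addrI (f 0)); rewrite -fD !addr0. Qed.

Lemma morphD_N : {morph f : x / - x}.
Proof. by move=> x; apply: (addrI (f x)); rewrite -fD !subrr morphD_0. Qed.

Lemma morphD_B : {morph f : x y / x - y}.
Proof. by move=> x y; rewrite fD morphD_N. Qed.

Lemma morphD_sum (I : Type) (r : seq I) (P : pred I) (F : I -> S) :
  f (\sum_(i <- r | P i) F i) = \sum_(i <- r | P i) f (F i).
Proof. exact: (big_morph f fD morphD_0). Qed.
End MorphAdd.

(* With [phi i = id] this gives the homogeneous components of a graded group,
   and with [phi j a = a *: e j] the coordinates in a basis [e]. *)
Lemma direct_sum_components (I : eqType) (C S : zmodType) (D : I -> set C)
    (phi : I -> C -> S) :
  (forall i, D i 0) ->
  (forall i c d, D i c -> D i d -> D i (c - d)) ->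
  (forall i, {morph phi i : c d / c + d}) ->
  (forall s, exists (r : seq I) (c : I -> C),
     (forall i, D i (c i)) /\ s = \sum_(i <- r) phi i (c i)) ->
  (forall (r : seq I) (c : I -> C), uniq r -> (forall i, D i (c i)) ->
     \sum_(i <- r) phi i (c i) = 0 -> forall i, i \in r -> c i = 0) ->
  exists comp : I -> S -> C,
  [/\ forall i s, D i (comp i s),
      forall i, {morph comp i : s t / s + t},
      forall i j c, D i c -> comp j (phi i c) = if j == i then c else 0 &
      forall s, exists r : seq I, s = \sum_(i <- r) phi i (comp i s)].
Proof.
move=> D0 DB phiD gen dir.
have DN i c : D i c -> D i (- c) by move=> Dc; rewrite -sub0r; exact: DB.
have DD i c d : D i c -> D i d -> D i (c + d).
  by move=> Dc Dd; rewrite -[d]opprK; apply: DB => //; exact: DN.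
have phi0 i : phi i 0 = 0 by exact: morphD_0.
(* [rep s c] says that [c] is a family of components of [s] with finite support. The list [r] only
   has to contain the support, so two families can be brought to a common list before they are
   added. *)
pose rep s (c : I -> C) := (forall i, D i (c i)) /\
  exists r : seq I, [/\ uniq r, forall i, i \notin r -> c i = 0 &
    s = \sum_(i <- r) phi i (c i)].
have widen (c : I -> C) (r r' : seq I) : uniq r -> uniq r' -> {subset r <= r'} ->
    (forall i, i \notin r -> c i = 0) ->
    \sum_(i <- r) phi i (c i) = \sum_(i <- r') phi i (c i).
  move=> ur ur' sub c0; rewrite [RHS](bigID (mem r)) /=.
  rewrite [X in _ + X]big1 => [|i /c0 ->]; last by rewrite phi0.
  rewrite addr0 -[RHS]big_filter; apply: perm_big; apply: uniq_perm => //.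
    exact: filter_uniq.
  by move=> i; rewrite mem_filter /=; case: (boolP (i \in r)) => // /sub ->.
have rep_single i c : D i c -> rep (phi i c) (fun j => if j == i then c else 0).
  move=> Dc; split=> [j|]; first by case: eqP => [->|].
  exists [:: i]; split=> //; last by rewrite big_seq1 eqxx.
  by move=> j; rewrite inE => /negPf ->.
have rep0 : rep 0 (fun=> 0).
  by split=> //; exists [::]; split=> //; rewrite big_nil.
have repD s t c d : rep s c -> rep t d -> rep (s + t) (fun i => c i + d i).
  move=> [Dc [r [ur c0 ->]]] [Dd [r' [ur' d0 ->]]]; split=> [i|]; first exact: DD.
  exists (undup (r ++ r')); rewrite undup_uniq; split=> //.
    move=> i; rewrite mem_undup mem_cat negb_or => /andP[ir ir'].
    by rewrite c0 // d0 // addr0.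
  rewrite (widen c r (undup (r ++ r'))) ?undup_uniq //; last first.
    by move=> i ir; rewrite mem_undup mem_cat ir.
  rewrite (widen d r' (undup (r ++ r'))) ?undup_uniq //; last first.
    by move=> i ir; rewrite mem_undup mem_cat ir orbT.
  by rewrite -big_split /=; apply: eq_bigr => i _; rewrite phiD.
have repN s c : rep s c -> rep (- s) (fun i => - c i).
  move=> [Dc [r [ur c0 ->]]]; split=> [i|]; first exact: DN.
  exists r; split=> // [i /c0 ->|]; first by rewrite oppr0.
  by rewrite -sumrN; apply: eq_bigr => i _; rewrite (morphD_N (@phiD i)).
(* The difference of the two families represents [0]: it vanishes on its list by directness, and off
   the list by the definition of [rep]. *)
have rep_uniq s c d : rep s c -> rep s d -> c = d.
  move=> sc sd; have := repD _ _ _ _ sc (repN _ _ sd).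
  rewrite subrr => -[De [r [ur e0 sum0]]]; apply/funext => i; apply/eqP.
  rewrite -subr_eq0; apply/eqP; have [ir|/e0 //] := boolP (i \in r).
  exact: (dir r (fun i => c i - d i) ur De).
have rep_ex s : exists c, rep s c.
  have [r [c [Dc ->]]] := gen s.
  elim: r => [|i r [d rd]]; first by rewrite big_nil; exists (fun=> 0).
  rewrite big_cons; exists (fun j => (if j == i then c i else 0) + d j).
  exact: repD (rep_single _ _ (Dc i)) rd.
have [f fP] := choice rep_ex.
exists (fun i s => f s i); split=> [i s|i s t|i j c Dc|s].
- by case: (fP s).
- by rewrite (rep_uniq _ _ _ (fP _) (repD _ _ _ _ (fP s) (fP t))).
- by rewrite (rep_uniq _ _ _ (fP _) (rep_single _ _ Dc)).
- by case: (fP s) => _ [r [_ _ ?]]; exists r.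
Qed.

(** * Graded sheaves *)

Section GradedSheaf.
Variables (M : topologicalType) (S : opn M -> zmodType).
Variables (res : forall U V : opn M, S U -> S V).
Variables (deg : forall U : opn M, int -> set (S U)).
Hypothesis gs : graded_sheaf res deg.

Lemma homogeneous_components_ex (U : opn M) : exists comp : int -> S U -> S U,
  [/\ forall k s, deg k (comp k s),
      forall k, {morph comp k : s t / s + t},
      forall k j s, deg k s -> comp j s = if j == k then s else 0 &
      forall s, exists r : seq int, s = \sum_(k <- r) comp k s].
Proof.
apply: (@direct_sum_components _ _ _ (@deg U) (fun=> id)) => //.
- exact: (gs_deg0 gs).
- exact: (gs_degB gs).
- exact: (gs_deg_sum gs).
- exact: (gs_deg_direct gs).
Qed.

Definition hcomp (U : opn M) : int -> S U -> S U :=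
  projT1 (cid (homogeneous_components_ex U)).

Lemma hcomp_deg U k (s : S U) : deg k (hcomp k s).
Proof. by rewrite /hcomp; case: cid => c []. Qed.

Lemma hcompD U k : {morph @hcomp U k : s t / s + t}.
Proof. by rewrite /hcomp; case: cid => c []. Qed.

Lemma hcompE U k j (s : S U) : deg k s -> hcomp j s = if j == k then s else 0.
Proof. by rewrite /hcomp; case: cid => c [? ? h ?]; exact: h. Qed.

Lemma hcomp_id U k (s : S U) : deg k s -> hcomp k s = s.
Proof. by move=> /(hcompE k) ->; rewrite eqxx. Qed.

Lemma hcomp_sum U (s : S U) : exists r : seq int, s = \sum_(k <- r) hcomp k s.
Proof. by rewrite /hcomp; case: cid => c [? ? ? h]; exact: h. Qed.

Lemma hcomp0 U k : hcomp k (0 : S U) = 0.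
Proof. exact: morphD_0 (@hcompD U k). Qed.

Lemma deg_hcomp U k (s : S U) : (forall j, j != k -> hcomp j s = 0) -> deg k s.
Proof.
move=> s0; suff <- : hcomp k s = s by exact: hcomp_deg.
have [r sE] := hcomp_sum s.
have sk : forall j, deg k (hcomp j s).
  move=> j; have [->|/s0 ->] := eqVneq j k; first exact: hcomp_deg.
  exact: (gs_deg0 gs).
rewrite [in RHS]sE {1}sE (morphD_sum (@hcompD U k)).
by apply: eq_bigr => j _; rewrite hcomp_id.
Qed.

Lemma degD U k (s t : S U) : deg k s -> deg k t -> deg k (s + t).
Proof.
by move=> ks kt; rewrite -(hcomp_id ks) -(hcomp_id kt) -hcompD; exact: hcomp_deg.
Qed.

Lemma gs_res0 (U V : opn M) : V `<=` U -> res V (0 : S U) = 0.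
Proof. by move=> VU; apply: morphD_0; exact: (gs_resD gs VU). Qed.

End GradedSheaf.

(** The images of the components of [s] are homogeneous of the same degrees and add up to [f s];
    directness in the target makes them its components. *)
Lemma hcomp_morph (M M' : topologicalType) (S : opn M -> zmodType)
    (S' : opn M' -> zmodType) res res' deg deg'
    (gs : @graded_sheaf M S res deg) (gs' : @graded_sheaf M' S' res' deg')
    (U : opn M) (U' : opn M') (f : S U -> S' U') :
  {morph f : s t / s + t} -> (forall k s, deg U k s -> deg' U' k (f s)) ->
  forall k s, hcomp gs' k (f s) = f (hcomp gs k s).
Proof.
move=> fD fdeg k s; have [r sE] := hcomp_sum gs s.
rewrite {1}sE {2}sE (morphD_sum fD) !(morphD_sum (@hcompD _ _ _ _ _ _ k)).
rewrite (morphD_sum fD); apply: eq_bigr => j _.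
have dj := hcomp_deg gs j s.
rewrite (hcompE gs k dj) (hcompE gs' k (fdeg _ _ dj)).
by case: eqP; rewrite ?(morphD_0 fD).
Qed.

(** * Locally generated submodules *)

Section Locally.
Variable M : topologicalType.
Implicit Types (U V W : opn M) (Q : opn M -> Prop).

Definition opnI U V : opn M := Opn (openI (oset_open U) (oset_open V)).

Lemma locally_self U Q : Q U -> locally U Q.
Proof. by move=> QU x Ux; exists U; split. Qed.

Lemma locally_imp U Q Q' : (forall V, V `<=` U -> Q V -> Q' V) ->
  locally U Q -> locally U Q'.
Proof.
by move=> QQ' lQ x /lQ[V [Vx VU QV]]; exists V; split=> //; exact: QQ'.
Qed.

Lemma locally_locally U Q : locally U (fun V => locally V Q) -> locally U Q.
Proof.
move=> lQ x /lQ[V [Vx VU lV]]; have [W [Wx WV QW]] := lV x Vx.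
by exists W; split=> //; exact: subset_trans VU.
Qed.

Lemma locally_sub U V Q : V `<=` U ->
  (forall W W', W `<=` U -> W' `<=` W -> Q W -> Q W') ->
  locally U Q -> locally V Q.
Proof.
move=> VU Qres lQ x Vx; have [W [Wx WU QW]] := lQ x (VU x Vx).
exists (opnI W V); split=> //=; apply: Qres WU _ QW => y [] //.
Qed.

Lemma locally_and U Q Q' :
  (forall W W', W `<=` U -> W' `<=` W -> Q W -> Q W') ->
  (forall W W', W `<=` U -> W' `<=` W -> Q' W -> Q' W') ->
  locally U Q -> locally U Q' -> locally U (fun V => Q V /\ Q' V).
Proof.
move=> Qres Qres' lQ lQ' x Ux.
have [W [Wx WU QW]] := lQ x Ux; have [W' [Wx' WU' QW']] := lQ' x Ux.
exists (opnI W W'); split=> //= [y [/WU]//|]; split.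
  by apply: Qres WU _ QW => y [].
by apply: Qres' WU' _ QW' => y [].
Qed.

End Locally.

Local Notation span := Defs.span.

Section Span.
Variables (S : pzRingType) (N : lmodType S).
Implicit Types X : set N.

Lemma span_gen X x : X x -> span X x.
Proof.
move=> Xx; exists 1%N, (fun=> 1), (fun=> x); split=> //.
by rewrite big_ord1 scale1r.
Qed.

Lemma span0 X : span X 0.
Proof.
by exists 0%N, (fun=> 0), (fun=> 0); split=> [[]//|]; rewrite big_ord0.
Qed.

Lemma spanD X s t : span X s -> span X t -> span X (s + t).
Proof.
move=> [n [a [x [Xx ->]]]] [m [b [y [Xy ->]]]].
pose pick T (f : 'I_n -> T) (g : 'I_m -> T) (k : 'I_(n + m)) :=
  match fintype.split k with inl i => f i | inr j => g j end.
exists (n + m)%N, (pick _ a b), (pick _ x y); split.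
  by move=> k; rewrite /pick; case: fintype.split.
rewrite big_split_ord /=; congr (_ + _); apply: eq_bigr => i _.
  by rewrite /pick (unsplitK (inl i)).
by rewrite /pick (unsplitK (inr i)).
Qed.

Lemma spanZ X a s : span X s -> span X (a *: s).
Proof.
move=> [n [b [x [Xx ->]]]]; exists n, (fun k => a * b k), x; split=> //.
by rewrite scaler_sumr; apply: eq_bigr => k _; rewrite scalerA.
Qed.

Lemma span_ind X (Q : N -> Prop) : Q 0 -> (forall s t, Q s -> Q t -> Q (s + t)) ->
  (forall a s, Q s -> Q (a *: s)) -> (forall x, X x -> Q x) ->
  forall s, span X s -> Q s.
Proof.
move=> Q0 QD QZ QX s [n [a [x [Xx ->]]]].
by apply: big_ind => // k _; apply: QZ; exact: QX.
Qed.

End Span.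

(** Isolates what generated submodules rely on, so that the same lemmas serve a module sheaf and the
    pairs of sections among which the graph of a map is generated. *)
Record module_presheaf (M : topologicalType) (A : ring_sheaf M)
    (P : forall U : opn M, lmodType (A U)) (res : forall U V, P U -> P V) : Prop :=
    ModulePresheaf {
  mp_resD : forall U V : opn M, V `<=` U -> {morph @res U V : s t / s + t};
  mp_resZ : forall U V : opn M, V `<=` U -> forall (a : A U) (s : P U),
    res U V (a *: s) = rres V a *: res U V s;
  mp_res_id : forall (U : opn M) s, res U U s = s;
  mp_res_comp : forall U V W : opn M, V `<=` U -> W `<=` V ->
    forall s, res V W (res U V s) = res U W s }.

Section LocallyGenerated.
Variables (M : topologicalType) (A : ring_sheaf M).
Variables (P : forall U : opn M, lmodType (A U)) (res : forall U V, P U -> P V).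
Hypothesis mp : module_presheaf res.
Variable X : forall U, set (P U).

(** The submodule sheaf generated by [X]. Both [filtration] and [pullback_summand] unfold to
    instances of it, so the lemmas below apply to them directly. *)
Definition locgen (U : opn M) : set (P U) :=
  [set s | locally U (fun V => span (X (U := V)) (res V s))].

Lemma locgen_ind (Q : forall U, P U -> Prop) :
  (forall U s, locally U (fun V => Q V (res V s)) -> Q U s) ->
  (forall U, Q U 0) -> (forall U s t, Q U s -> Q U t -> Q U (s + t)) ->
  (forall U (a : A U) s, Q U s -> Q U (a *: s)) ->
  (forall U s, X s -> Q U s) ->
  forall U s, locgen (U := U) s -> Q U s.
Proof.
move=> Qloc Q0 QD QZ QX U s gs; apply: Qloc; apply: locally_imp gs => V VU.
by apply: span_ind => // ? ?; [exact: QD | exact: QZ | exact: QX].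
Qed.

Lemma locgen_gen U s : X s -> locgen (U := U) s.
Proof.
by move=> Xs; apply: locally_self; rewrite (mp_res_id mp); exact: span_gen.
Qed.

Lemma locgen_local U s :
  locally U (fun V => locgen (res V s)) -> locgen (U := U) s.
Proof.
move=> ls; apply: locally_locally; apply: locally_imp ls => V VU.
by apply: locally_imp => W WV; rewrite (mp_res_comp mp).
Qed.

Lemma locgen0 U : locgen (0 : P U).
Proof.
by apply: locally_self; rewrite (mp_res_id mp); exact: span0.
Qed.

Lemma locgenZ U (a : A U) s : locgen s -> locgen (a *: s).
Proof.
by apply: locally_imp => V VU; rewrite (mp_resZ mp VU); exact: spanZ.
Qed.

Hypothesis Xres : forall U V : opn M, V `<=` U ->
  forall s, X s -> X (U := V) (res (U := U) V s).

Lemma span_res (U V : opn M) : V `<=` U ->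
  forall s, span (X (U := U)) s -> span (X (U := V)) (res V s).
Proof.
move=> VU; apply: span_ind => [|s t|a s|s].
- by rewrite (morphD_0 (mp_resD mp VU)); exact: span0.
- by rewrite (mp_resD mp VU); exact: spanD.
- by rewrite (mp_resZ mp VU); exact: spanZ.
- by move=> /(Xres VU); exact: span_gen.
Qed.

Let stable (U : opn M) (s : P U) (W W' : opn M) : W `<=` U -> W' `<=` W ->
  span (X (U := W)) (res W s) -> span (X (U := W')) (res W' s).
Proof. by move=> WU WW' /(span_res WW'); rewrite (mp_res_comp mp). Qed.

Lemma locgenD U s t : locgen s -> locgen t -> locgen (U := U) (s + t).
Proof.
move=> ls lt; have := locally_and (@stable U s) (@stable U t) ls lt.
apply: locally_imp => V VU [sV tV]; rewrite (mp_resD mp VU); exact: spanD.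
Qed.

Lemma locgen_res (U V : opn M) : V `<=` U ->
  forall s, locgen (U := U) s -> locgen (res V s).
Proof.
move=> VU s /(locally_sub VU (@stable U s)).
by apply: locally_imp => W WV; rewrite (mp_res_comp mp).
Qed.

End LocallyGenerated.

(** * Homogeneous components in sheaves of modules *)

Lemma module_sheaf_presheaf (M : topologicalType) (A : ring_sheaf M)
  (P : module_sheaf A) : module_presheaf (@mres M A P).
Proof.
split.
- by move=> U V VU s t; exact: (gs_resD (msheaf P)).
- exact: mresZ.
- exact: (gs_res_id (msheaf P)).
- exact: (gs_res_comp (msheaf P)).
Qed.

Section ModuleSheaf.
Variables (M : topologicalType) (A : ring_sheaf M) (P : module_sheaf A).

Lemma mresD (U V : opn M) : V `<=` U -> {morph @mres _ _ P U V : s t / s + t}.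
Proof. exact: (mp_resD (module_sheaf_presheaf P)). Qed.

Lemma mres_comp (U V W : opn M) : V `<=` U -> W `<=` V ->
  forall s : P U, mres W (mres V s) = mres W s.
Proof. exact: (mp_res_comp (module_sheaf_presheaf P)). Qed.

Lemma hcompZ U k l (a : A U) (s : P U) : rdeg l a ->
  hcomp (msheaf P) k (a *: s) = a *: hcomp (msheaf P) (k - l) s.
Proof.
move=> da; have [r sE] := hcomp_sum (msheaf P) s.
have [k' kE] : exists k', k' = k - l by exists (k - l).
rewrite -kE {1}sE {2}sE scaler_sumr !(morphD_sum (@hcompD _ _ _ _ _ _ _)).
rewrite scaler_sumr; apply: eq_bigr => j _.
have dj := hcomp_deg (msheaf P) j s.
rewrite (hcompE _ k (mdegZ da dj)) (hcompE _ k' dj) kE subr_eq addrC.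
by case: eqP => //; rewrite scaler0.
Qed.

Lemma hcomp_mres (U V : opn M) : V `<=` U -> forall k (s : P U),
  hcomp (msheaf P) k (mres V s) = mres V (hcomp (msheaf P) k s).
Proof.
move=> VU; apply: hcomp_morph; first exact: mresD.
exact: (gs_deg_res (msheaf P)).
Qed.

End ModuleSheaf.

(** * The projection of a pullback onto its part generated in one degree *)

Section PullbackProjection.
Variables (M : topologicalType) (O A : ring_sheaf M) (pi : ring_sheaf_map O A).
Variables (E : module_sheaf O) (PE : module_sheaf A).
Variable eta : semilinear_map pi E PE.
Hypothesis hPE : is_pullback eta.
Hypothesis O_deg0 : forall U (a : O U), rdeg 0 a.

Lemma hcomp_eta U k (x : E U) :
  hcomp (msheaf PE) k (eta U x) = eta U (hcomp (msheaf E) k x).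
Proof. apply: hcomp_morph; [exact: smapD | exact: smap_deg]. Qed.

(** The sections [eta U x] generate [PE] locally, so this is [locgen_ind] applied to the range of
    [eta]. *)
Lemma pullback_ind (Q : forall U, PE U -> Prop) :
  (forall U s, locally U (fun V => Q V (mres V s)) -> Q U s) ->
  (forall U, Q U 0) -> (forall U s t, Q U s -> Q U t -> Q U (s + t)) ->
  (forall U (a : A U) s, Q U s -> Q U (a *: s)) ->
  (forall U x, Q U (eta U x)) ->
  forall U s, Q U s.
Proof.
move=> Qloc Q0 QD QZ QX U s.
apply: (@locgen_ind _ _ _ (@mres M A PE) (fun U => range (eta U))) => //.
  by move=> V _ [x _ <-].
apply: locally_imp (pb_generated hPE s) => V VU [n [a [x ->]]].
by exists n, a, (fun k => eta V (x k)); split=> // k; exists (x k).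
Qed.

(** Graded form of the previous induction. Applying [pullback_ind] to all components of [s] at once
    works because the degree [k] part of [a *: s] is the sum of the products of the degree [l] part
    of [a] with the degree [k - l] part of [s]. *)
Lemma pullback_hcomp_ind (Q : forall U, int -> PE U -> Prop) :
  (forall U k s, locally U (fun V => Q V k (mres V s)) -> Q U k s) ->
  (forall U k, Q U k 0) ->
  (forall U k s t, Q U k s -> Q U k t -> Q U k (s + t)) ->
  (forall U l (a : A U) k s, rdeg l a -> Q U (k - l) s -> mdeg (k - l) s ->
     Q U k (a *: s)) ->
  (forall U k x, mdeg k x -> Q U k (eta U x)) ->
  forall U k s, mdeg k s -> Q U k s.
Proof.
move=> Qloc Q0 QD QZ QX U k s ks; rewrite -(hcomp_id (msheaf PE) ks).
move: k {ks}.
apply: (@pullback_ind (fun U s => forall k, Q U k (hcomp (msheaf PE) k s))).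
- move=> {U s}U s ls k; apply: Qloc; apply: locally_imp ls => V VU.
  by move=> /(_ k); rewrite hcomp_mres.
- by move=> {U s}U k; rewrite hcomp0.
- by move=> {U s}U s t Qs Qt k; rewrite hcompD; exact: QD.
- move=> {U s}U a s Qs k; have [r ->] := hcomp_sum (rsheaf A) a.
  rewrite scaler_suml (morphD_sum (@hcompD _ _ _ _ _ _ _)).
  apply: big_ind => [||l _] //; first exact: QD.
  have dl := hcomp_deg (rsheaf A) l a.
  by rewrite (hcompZ _ _ dl); apply: QZ => //; exact: hcomp_deg.
- by move=> {U s}U x k; rewrite hcomp_eta; apply: QX; exact: hcomp_deg.
Qed.

Variable i : int.

Let pairs (U : opn M) : lmodType (A U) := (PE U * PE U)%type.

Let pres (U V : opn M) (p : pairs U) : pairs V := (mres V p.1, mres V p.2).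

Let pairs_presheaf : module_presheaf pres.
Proof.
split.
- by move=> U V VU s t; rewrite /pres /= !mresD.
- by move=> U V VU a s; rewrite /pres /= !mresZ.
- by move=> U [s t]; rewrite /pres !(mp_res_id (module_sheaf_presheaf PE)).
- by move=> U V W VU WV [s t]; rewrite /pres /= !mres_comp.
Qed.

(* The map [pi^* p] for the projection [p] of [E] onto its part of degree [i]
   is built from its graph, so that only its values have to be glued. *)
Let graph_gen (U : opn M) : set (pairs U) :=
  range (fun x : E U => (eta U x, eta U (hcomp (msheaf E) i x))).

Let graph (U : opn M) (q t : PE U) : Prop := locgen pres graph_gen (U := U) (q, t).

Let graph_gen_res (U V : opn M) : V `<=` U ->
  forall s, graph_gen s -> graph_gen (U := V) (pres (U := U) V s).
Proof.
move=> VU _ [x _ <-]; exists (mres V x) => //.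
by rewrite /pres /= hcomp_mres // !smap_res.
Qed.

Let graphD U q q' t t' : @graph U q t -> graph q' t' -> graph (q + q') (t + t').
Proof. exact: (locgenD pairs_presheaf graph_gen_res). Qed.

Let graphZ U a q t : @graph U q t -> graph (a *: q) (a *: t).
Proof. exact: (locgenZ pairs_presheaf). Qed.

Let graph0 U : @graph U 0 0.
Proof. exact: (locgen0 pairs_presheaf). Qed.

Let graph_res (U V : opn M) q t : V `<=` U -> @graph U q t -> graph (mres V q) (mres V t).
Proof. move=> VU; exact: (locgen_res pairs_presheaf graph_gen_res VU). Qed.

Let graph_local U q t :
  locally U (fun V => graph (mres V q) (mres V t)) -> @graph U q t.
Proof. exact: (@locgen_local _ _ _ _ pairs_presheaf graph_gen U (q, t)). Qed.

Let graph_eta U x : @graph U (eta U x) (eta U (hcomp (msheaf E) i x)).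
Proof. by apply: (locgen_gen pairs_presheaf); exists x. Qed.

(** This makes the projection well defined. A relation between the [eta V (x k)] makes the
    corresponding tensor vanish locally, and testing the tensor on [(c, z) |-> c *: eta W z_i], with
    [z_i] the degree [i] part of [z], gives the same relation between the projected sections. The
    test map is balanced because scalars in [O] have degree 0 and so commute with taking
    components. *)
Let graph_eq0 U t : @graph U 0 t -> t = 0.
Proof.
move=> gt; apply: (gs_separated (msheaf PE)); apply: locally_locally.
apply: locally_imp gt => V VU [n [a [y [Xy yE]]]].
have [x xE] : exists x : 'I_n -> E V, forall k,
    y k = (eta V (x k), eta V (hcomp (msheaf E) i (x k))).
  suff /choice[x xE] : forall k, exists x,
      y k = (eta V x, eta V (hcomp (msheaf E) i x)) by exists x.
  by move=> k; have [x _ <-] := Xy k; exists x.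
have tE : mres V t = \sum_(k < n) a k *: eta V (hcomp (msheaf E) i (x k)).
  have := congr1 snd yE; rewrite /= => ->.
  by rewrite (morphD_sum (f := snd)) //; apply: eq_bigr => k _; rewrite xE.
have : \sum_(k < n) a k *: eta V (x k) = 0.
  have := congr1 fst yE; rewrite /= (gs_res0 (msheaf PE) VU) => /esym.
  rewrite (morphD_sum (f := fst)) // => yE0; rewrite -[RHS]yE0.
  by apply: eq_bigr => k _; rewrite xE.
move=> /(pb_relations hPE); apply: locally_imp => W WV tz.
rewrite -(mres_comp VU WV) tE (morphD_sum (mresD WV)).
rewrite -[RHS](tz _ (fun c z => c *: eta W (hcomp (msheaf E) i z))).
- apply: eq_bigr => k _.
  by rewrite mresZ // hcomp_mres // smap_res.
- by move=> c d z; rewrite scalerDl.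
- by move=> c z z'; rewrite hcompD smapD scalerDr.
- by move=> c s z; rewrite (hcompZ _ _ (O_deg0 s)) subr0 smapZ scalerA.
Qed.

Let graph_uniq U q t t' : @graph U q t -> graph q t' -> t = t'.
Proof.
move=> gt gt'; apply/eqP; rewrite -subr_eq0; apply/eqP/graph_eq0.
by have := graphD gt (graphZ (-1) gt'); rewrite !scaleN1r subrr.
Qed.

(** Gluing is available only within a fixed degree, so a value is built for homogeneous [q],
    together with the fact that it has the same degree. *)
Let graph_homogeneous U k q : mdeg k q -> exists t, mdeg k t /\ @graph U q t.
Proof.
apply: (@pullback_hcomp_ind (fun U k q => exists t, mdeg k t /\ @graph U q t));
  move=> {U q}U {}k.
(* The cover consists of all opens on which a homogeneous value exists. The chosen values agree on
   overlaps by [graph_uniq], hence glue. *)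
- move=> s ls; pose I := {V : opn M | V `<=` U /\
    exists t, mdeg k t /\ graph (mres V s) t}.
  pose c (j : I) := cid (proj2 (proj2_sig j)).
  have dc j : mdeg k (projT1 (c j)) by case: (projT2 (c j)).
  have gc j : graph (mres (sval j) s) (projT1 (c j)) by case: (projT2 (c j)).
  have [|||t [dt tE]] := @gs_glue _ _ _ _ (msheaf PE) U k I
    (fun j => sval j) (fun j => projT1 (c j)).
  + apply/seteqP; split=> [x /ls[V [Vx VU exV]]|x [[V [VU ?]] _] /=].
      by exists (exist _ V (conj VU exV)).
    exact: VU.
  + exact: dc.
  + move=> j j' W Wj Wj'.
    have [jU _] := svalP j; have [jU' _] := svalP j'.
    apply: graph_uniq (graph_res Wj (gc j)) _.
    by have := graph_res Wj' (gc j'); rewrite !mres_comp.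
  + exists t; split=> //; apply: graph_local => x /ls[V [Vx VU exV]].
    exists V; split=> //; have := tE (exist _ V (conj VU exV)).
    by move=> /= ->; exact: (gc (exist _ V (conj VU exV))).
- by exists 0; split; [exact: (gs_deg0 (msheaf PE)) | exact: graph0].
- move=> s t [s' [ds gs]] [t' [dt gt]]; exists (s' + t').
  by split; [exact: degD (msheaf PE) _ _ _ _ _ _ | exact: graphD].
- move=> a j s da [t [dt gt]] _; exists (a *: t); split; last exact: graphZ.
  by have := mdegZ da dt; rewrite addrC subrK.
- move=> x dx; exists (eta U (hcomp (msheaf E) i x)); split; last exact: graph_eta.
  apply: smap_deg; rewrite (hcompE _ i dx); case: eqP => // _.
  exact: (gs_deg0 (msheaf E)).
Qed.

Let graph_total U q : exists t, @graph U q t.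
Proof.
have [r ->] := hcomp_sum (msheaf PE) q; elim: r => [|k r [t gt]].
  by rewrite big_nil; exists 0; exact: graph0.
rewrite big_cons.
have [t' [_ gt']] := graph_homogeneous (hcomp_deg (msheaf PE) k q).
by exists (t' + t); exact: graphD.
Qed.

(** The map is read off from its graph: by [graph_uniq], each closure property of [graph] becomes
    the corresponding identity for the chosen values. *)
Lemma pullback_projection_ex : exists p : forall U, PE U -> PE U,
  [/\ forall U, {morph p U : s t / s + t},
      forall U (a : A U) s, p U (a *: s) = a *: p U s,
      forall U V : opn M, V `<=` U -> forall s, p V (mres V s) = mres V (p U s) &
      forall U x, p U (eta U x) = eta U (hcomp (msheaf E) i x)].
Proof.
pose p U (q : PE U) := projT1 (cid (graph_total q)).
have pP U q : graph q (@p U q) by rewrite /p; case: cid.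
exists p; split.
- move=> U s t; exact: graph_uniq (pP _ _) (graphD (pP _ _) (pP _ _)).
- move=> U a s; exact: graph_uniq (pP _ _) (graphZ a (pP _ _)).
- move=> U V VU s; exact: graph_uniq (pP _ _) (graph_res VU (pP _ _)).
- move=> U x; exact: graph_uniq (pP _ _) (graph_eta x).
Qed.

End PullbackProjection.

(** * The filtration and its graded pieces *)

Lemma locgenS (M : topologicalType) (A : ring_sheaf M)
    (P : forall U : opn M, lmodType (A U)) (res : forall U V, P U -> P V)
    (X Y : forall U, set (P U)) :
  (forall U, X U `<=` Y U) -> forall U, locgen res X (U := U) `<=` locgen res Y (U := U).
Proof.
move=> XY U s; apply: locally_imp => V VU [n [a [x [Xx ->]]]].
by exists n, a, x; split=> // k; exact: XY.
Qed.

Section Filtration.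
Variables (M : topologicalType) (A : ring_sheaf M) (P : module_sheaf A).
Variable i : int.

Let mp := module_sheaf_presheaf P.

Let deg_le U : set (P U) := [set t | exists2 j : int, j <= i & mdeg j t].

Let deg_le_res (U V : opn M) : V `<=` U ->
  forall s, deg_le s -> deg_le (U := V) (mres (U := U) V s).
Proof. by move=> VU s [j ji sj]; exists j => //; exact: (gs_deg_res (msheaf P)). Qed.

Lemma filtration_gen U j (s : P U) : j <= i -> mdeg j s -> filtration i s.
Proof. by move=> ji sj; apply: (locgen_gen mp); exists j. Qed.

Lemma filtration0 U : filtration i (0 : P U).
Proof. exact: (locgen0 mp). Qed.

Lemma filtrationD U (s t : P U) :
  filtration i s -> filtration i t -> filtration i (s + t).
Proof. exact: (locgenD mp deg_le_res). Qed.

Lemma filtrationZ U (a : A U) (s : P U) : filtration i s -> filtration i (a *: s).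
Proof. exact: (locgenZ mp). Qed.

Lemma filtration_local U (s : P U) :
  locally U (fun V => filtration i (mres V s)) -> filtration i s.
Proof. exact: (@locgen_local _ _ _ _ mp deg_le). Qed.

End Filtration.

Section GradedPieces.
Variables (M : topologicalType) (O A : ring_sheaf M).
Variables (pi : ring_sheaf_map O A) (zero : ring_sheaf_map A O).
Hypothesis O_deg0 : forall U (a : O U), rdeg 0 a.
Hypothesis A_neg : forall U k (a : A U), k < 0 -> rdeg k a -> a = 0.
Hypothesis A_deg0 : forall U (a : A U), rdeg 0 a -> exists g, a = pi U g.
Hypothesis zero_pos : forall U k (a : A U), 0 < k -> rdeg k a -> zero U a = 0.
Hypothesis zeroK : forall U g, zero U (pi U g) = g.
Variables (E : module_sheaf O) (PE : module_sheaf A).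
Variable eta : semilinear_map pi E PE.
Hypothesis hPE : is_pullback eta.
Variable zPE : semilinear_map zero PE E.
Hypothesis zPEK : forall U e, zPE U (eta U e) = e.

(** The filtration of [PE] is generated by arbitrary sections of degree at most [i]; this replaces
    them by pullbacks of sections of [E]. A section of degree [j] is locally a combination of
    [eta x] with [x] of degree at most [j], since coefficients have nonnegative degree. *)
Lemma filtration_pullback_ind i (Q : forall U, PE U -> Prop) :
  (forall U s, locally U (fun V => Q V (mres V s)) -> Q U s) ->
  (forall U, Q U 0) -> (forall U s t, Q U s -> Q U t -> Q U (s + t)) ->
  (forall U (a : A U) s, Q U s -> Q U (a *: s)) ->
  (forall U j x, j <= i -> mdeg j x -> Q U (eta U x)) ->
  forall U s, filtration i s -> Q U s.
Proof.
move=> Qloc Q0 QD QZ QX U s.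
apply: (@locgen_ind _ _ _ (@mres M A PE)) => // {U s}U s [j ji sj].
pose low k V := eta V @` [set e | exists2 l : int, l <= k & mdeg l e].
have : locgen (@mres M A PE) (low j) s.
  apply: (pullback_hcomp_ind hPE
    (Q := fun U j s => @locgen M A _ (@mres M A PE) (low j) U s)) sj.
  - by move=> {U s ji}U k s; exact: (locgen_local (module_sheaf_presheaf PE)).
  - by move=> *; exact: (locgen0 (module_sheaf_presheaf PE)).
  - move=> {U s ji}U k s t; apply: (locgenD (module_sheaf_presheaf PE)).
    move=> V W WV _ [e [l lk el] <-]; exists (mres W e); last exact: smap_res.
    by exists l => //; exact: (gs_deg_res (msheaf E)).
  (* A coefficient of negative degree is zero; one of degree [l >= 0] multiplies generators of
     degree at most [k - l], which is at most [k]. *)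
  - move=> {U s ji}U l a k s da gs _.
    have [l0|l0] := ltP l 0.
      rewrite (A_neg l0 da) scale0r; exact: (locgen0 (module_sheaf_presheaf PE)).
    apply: (locgenZ (module_sheaf_presheaf PE)); move: gs; apply: locgenS.
    move=> V _ [e [m mk em] <-]; exists e => //; exists m => //.
    by apply: le_trans mk _; rewrite gerBl.
  - move=> {U s ji}U k x kx; apply: (locgen_gen (module_sheaf_presheaf PE)).
    by exists x => //; exists k.
apply: (@locgen_ind _ _ _ (@mres M A PE)) => // V _ [e [l lj el] <-].
exact: QX (le_trans lj ji) el.
Qed.

(** The witness is the projection [p] onto the part generated in degree [i]. Its kernel on [F_i] is
    [F_(i-1)] because [p] kills [F_(i-1)] and [s - p s] lies in [F_(i-1)] for every [s] in [F_i]. *)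
Lemma pullback_graded_piece i :
  exists sigma, is_graded_piece_iso zPE eta i sigma.
Proof.
have [p [pD pZ pres peta]] := pullback_projection_ex hPE O_deg0 i.
have pdeg U j x : mdeg j x -> p U (eta U x) = if i == j then eta U x else 0.
  rewrite peta => /(hcompE (msheaf E) i) ->.
  by case: eqP => // _; exact: (morphD_0 (smapD eta (U := U))).
have p_low U s : filtration (i - 1) s -> p U s = 0.
  apply: (filtration_pullback_ind (Q := fun U s => p U s = 0)).
  - move=> {U s}U s ls; apply: (gs_separated (msheaf PE)).
    by apply: locally_imp ls => V VU; rewrite pres.
  - by move=> V; exact: morphD_0 (pD V).
  - by move=> {U s}U s t s0 t0; rewrite pD s0 t0 addr0.
  - by move=> {U s}U a s s0; rewrite pZ s0 scaler0.
  - move=> V j x ji /pdeg ->; case: eqP => // ij.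
    by move: ji; rewrite -ij lerBrDr gerDl.
have p_sub U s : filtration i s -> filtration (i - 1) (s - p U s).
  apply: (filtration_pullback_ind (Q := fun U s => filtration (i - 1) (s - p U s))).
  - move=> {U s}U s ls; apply: filtration_local; apply: locally_imp ls => V VU.
    by rewrite (morphD_B (@mresD _ _ PE _ _ VU)) pres.
  - by move=> V; rewrite (morphD_0 (pD V)) subr0; exact: filtration0.
  - by move=> {U s}U s t Fs Ft; rewrite pD opprD addrACA; exact: filtrationD.
  - by move=> {U s}U a s Fs; rewrite pZ -scalerBr; exact: filtrationZ.
  - move=> V j x ji xj; rewrite (pdeg _ _ _ xj).
    case: eqP => [_|/eqP ij]; first by rewrite subrr; exact: filtration0.
    rewrite subr0; apply: filtration_gen (smap_deg eta xj).
    by rewrite lerBrDr lezD1 lt_neqAle eq_sym ij.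
have summand_gen U x : mdeg i x -> pullback_summand eta i (eta U x).
  by move=> xi; apply: (locgen_gen (module_sheaf_presheaf PE)); exists x.
exists p; split.
- by move=> U s t _ _; exact: pD.
- by move=> U a s _; exact: pZ.
- by move=> U V VU s _; exact: pres.
- move=> U s _; apply: (pullback_ind hPE
    (Q := fun U s => pullback_summand eta i (p U s))).
  + move=> {U s}U s ls; apply: (locgen_local (module_sheaf_presheaf PE)).
    by apply: locally_imp ls => V VU; rewrite pres.
  + move=> V; rewrite (morphD_0 (pD V)).
    exact: (locgen0 (module_sheaf_presheaf PE)).
  + move=> {U s}U s t; rewrite pD; apply: (locgenD (module_sheaf_presheaf PE)).
    move=> V W WV _ [e ei <-]; exists (mres W e); last exact: smap_res.
    exact: (gs_deg_res (msheaf E)).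
  + move=> {U s}U a s; rewrite pZ; exact: (locgenZ (module_sheaf_presheaf PE)).
  + by move=> V x; rewrite peta; apply: summand_gen; exact: hcomp_deg.
- move=> U s Fs; split=> [s0|]; last exact: p_low.
  by have := p_sub _ _ Fs; rewrite s0 subr0.
(* The summand lies in [F_i] and [p] fixes it, so [q] is its own preimage over all of [U]. *)
- move=> U q gq; apply: locally_self; exists (mres U q).
    rewrite (mp_res_id (module_sheaf_presheaf PE)).
    move: gq; apply: locally_imp => V VU; apply: span_ind.
    + exact: span0.
    + by move=> *; exact: spanD.
    + by move=> *; exact: spanZ.
    + by move=> _ [e ei <-]; apply: span_gen; exists i => //; exact: smap_deg.
  rewrite (mp_res_id (module_sheaf_presheaf PE)).
  move: U q gq; apply: (@locgen_ind _ _ _ (@mres M A PE)).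
  + move=> U q ls; apply: (@subr0_eq (PE U)); apply: (gs_separated (msheaf PE)).
    apply: locally_imp ls => V VU.
    by rewrite (morphD_B (@mresD _ _ PE _ _ VU)) -pres // => ->; rewrite subrr.
  + by move=> V; exact: morphD_0 (pD V).
  + by move=> U s t sE tE; rewrite pD sE tE.
  + by move=> U a s sE; rewrite pZ sE.
  + by move=> U _ [e ei <-]; rewrite (pdeg _ _ _ ei) eqxx.
- move=> U b bi.
  (* Induction over homogeneous sections, with [k = i] kept as a premise. For a product of [a] of
     degree [l] with [s] of degree [i - l]: if [l < 0] then [a = 0]; if [l > 0] then [zero] kills
     [a] and [p] kills [s], which is in [F_(i-1)]; if [l = 0] then [a] comes from [O] and the
     induction hypothesis applies. *)
  have pz : forall U k s, mdeg k s -> k = i -> p U s = eta U (zPE U s).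
    apply: (pullback_hcomp_ind hPE
      (Q := fun U k s => k = i -> p U s = eta U (zPE U s))).
    + move=> V k s ls ki; apply: (@subr0_eq (PE V)).
      apply: (gs_separated (msheaf PE)); apply: locally_imp ls => W WV.
      rewrite (morphD_B (@mresD _ _ PE _ _ WV)) -pres // => -> //.
      by rewrite !smap_res // subrr.
    + move=> V k _; rewrite (morphD_0 (pD V)).
      by rewrite (morphD_0 (smapD zPE (U := V))) (morphD_0 (smapD eta (U := V))).
    + by move=> V k s t sE tE ki; rewrite pD sE // tE // !smapD.
    + move=> V l a k s da sE ds ki; rewrite pZ smapZ.
      case: (ltgtP l 0) => [l0|l0|l0].
      * rewrite (A_neg l0 da) scale0r (morphD_0 (rmapD zero (U := V))) scale0r.
        by rewrite (morphD_0 (smapD eta (U := V))).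
      * rewrite (zero_pos l0 da) scale0r (morphD_0 (smapD eta (U := V))).
        rewrite p_low ?scaler0 //; apply: filtration_gen ds.
        by rewrite ki lerD2l lerN2 -gtz0_ge1.
      * rewrite l0 in da sE; have [g gE] := A_deg0 da.
        by rewrite sE ?subr0 // gE zeroK smapZ.
    + by move=> V k x kx ki; rewrite (pdeg _ _ _ kx) ki eqxx zPEK.
  exact: pz bi erefl.
Qed.

End GradedPieces.

(** * Isomorphisms, filtrations and frames *)

Lemma filtration_map (M : topologicalType) (A : ring_sheaf M)
    (P Q : module_sheaf A) (T : linear_map P Q) i U (s : P U) :
  filtration i s -> filtration i (T U s).
Proof.
apply: locally_imp => V VU; rewrite -smap_res //.
apply: (span_ind (Q := fun x => span _ (T V x))).
- by rewrite (morphD_0 (smapD T (U := V))); exact: span0.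
- by move=> x y; rewrite smapD; exact: spanD.
- by move=> a x; rewrite smapZ; exact: spanZ.
- by move=> x [j ji xj]; apply: span_gen; exists j => //; exact: (smap_deg T).
Qed.

Section Isomorphism.
Variables (M : topologicalType) (A : ring_sheaf M) (P Q : module_sheaf A).
Variable T : linear_map P Q.
Hypothesis T_iso : is_isomorphism T.

(** [is_isomorphism] asks for bijectivity only, so the inverse has to be shown to preserve degrees:
    [T] commutes with taking components, and being injective it detects which of them vanish. *)
Lemma isomorphism_deg U k (s : P U) : mdeg k (T U s) -> mdeg k s.
Proof.
move=> Tk; apply: (deg_hcomp (gs := msheaf P)) => j jk.
apply: (bij_inj (T_iso U)); rewrite (morphD_0 (smapD T (U := U))).
rewrite -(hcomp_morph (msheaf P) (msheaf Q) (smapD T (U := U)) (smap_deg T (U := U))).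
by rewrite (hcompE _ j Tk) (negPf jk).
Qed.

Lemma isomorphism_inverse : exists G : linear_map Q P,
  (forall U, cancel (T U) (G U)) /\ (forall U, cancel (G U) (T U)).
Proof.
have inv U : exists g : Q U -> P U, cancel (T U) g /\ cancel g (T U).
  by case: (T_iso U) => g TK gK; exists g.
pose g U := projT1 (cid (inv U)).
have TK U : cancel (T U) (g U) by case: (projT2 (cid (inv U))).
have gK U : cancel (g U) (T U) by case: (projT2 (cid (inv U))).
have Tinj U : injective (T U) := can_inj (TK U).
have gD U (s t : Q U) : g U (s + t) = g U s + g U t.
  by apply: Tinj; rewrite smapD !gK.
have gZ U (a : A U) (s : Q U) : g U (a *: s) = a *: g U s.
  by apply: Tinj; rewrite smapZ !gK.
have gres (U V : opn M) : V `<=` U ->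
    forall s : Q U, g V (mres V s) = mres V (g U s).
  by move=> VU s; apply: Tinj; rewrite smap_res // !gK.
have gdeg U k (s : Q U) : mdeg k s -> mdeg k (g U s).
  by move=> ks; apply: isomorphism_deg; rewrite gK.
by exists (@SemilinearMap M A A (ring_sheaf_id A) Q P g gD gZ gres gdeg).
Qed.

Lemma filtration_isomorphism i U (s : P U) :
  filtration i (T U s) <-> filtration i s.
Proof.
split; last exact: filtration_map.
by have [G [TK _]] := isomorphism_inverse; move=> /(filtration_map G); rewrite TK.
Qed.

(** Frames are given for the bundle [B]; this carries them over to its pullback model [PE]. *)
Lemma is_frame_isomorphism rk U (e : frame_label rk -> P U) :
  is_frame e -> is_frame (fun j => T U (e j)).
Proof.
move=> [e_deg e_free]; split=> [j|V VU]; first exact: (smap_deg T).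
have [gen free] := e_free V VU; have [G [TK GK]] := isomorphism_inverse.
have TE (js : seq (frame_label rk)) (a : frame_label rk -> A V) :
    T V (\sum_(j <- js) a j *: mres V (e j)) =
    \sum_(j <- js) a j *: mres V (T U (e j)).
  rewrite (morphD_sum (smapD T (U := V))); apply: eq_bigr => j _.
  by rewrite smapZ smap_res.
split=> [s|js a ujs].
  by have [js [a sE]] := gen (G V s); exists js, a; rewrite -TE -sE GK.
rewrite -TE -[RHS](morphD_0 (smapD T (U := V))) => /(can_inj (TK V)).
exact: free.
Qed.

End Isomorphism.

(** Coordinates in a frame come from [direct_sum_components] with the maps [a |-> a *: e j].
    Linearity and compatibility with restriction are then checked on multiples of frame elements. *)
Lemma frame_coordinates (M : topologicalType) (A : ring_sheaf M)
    (P : module_sheaf A) rk (U : opn M) (e : frame_label rk -> P U) :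
  is_frame e ->
  exists xi : frame_label rk -> forall W, P W -> A W,
    (forall j, fibre_linear U (xi j)) /\
    forall W : opn M, W `<=` U -> forall s : P W, exists js,
      s = \sum_(j <- js) xi j W s *: mres W (e j).
Proof.
move=> [_ e_free].
have xi_ex W : exists xi : frame_label rk -> P W -> A W, W `<=` U ->
    [/\ forall j, {morph xi j : s t / s + t},
        forall i j c, xi j (c *: mres W (e i)) = if j == i then c else 0 &
        forall s, exists js, s = \sum_(j <- js) xi j s *: mres W (e j)].
  (* On opens not contained in [U] the coordinates get the default value 0; [fibre_linear U]
     constrains only opens inside [U]. *)
  have [WU|nWU] := pselect (W `<=` U); last by exists (fun _ _ => 0).
  have [gen free] := e_free W WU.
  have [|||||xi [_ xiD xiE xi_sum]] :=
      @direct_sum_components (frame_label rk) (A W) (P W) (fun=> setT)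
      (fun j a => a *: mres W (e j)) => //.
  - by move=> j c d; rewrite scalerDl.
  - by move=> s; have [js [a ->]] := gen s; exists js, a.
  - by move=> js c ujs _; exact: free.
  by exists xi => _; split=> // i j c; exact: xiE.
pose xi j W := projT1 (cid (xi_ex W)) j.
have xiD (W : opn M) : W `<=` U -> forall j, {morph xi j W : s t / s + t}.
  by move=> /(projT2 (cid (xi_ex W)))[].
have xiE (W : opn M) : W `<=` U -> forall i j c,
    xi j W (c *: mres W (e i)) = if j == i then c else 0.
  by move=> /(projT2 (cid (xi_ex W)))[].
have xi_sum (W : opn M) : W `<=` U -> forall s, exists js,
    s = \sum_(j <- js) xi j W s *: mres W (e j).
  by move=> /(projT2 (cid (xi_ex W)))[].
exists xi; split=> // j; split.
- by move=> W WU s t; exact: xiD.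
- move=> W WU a s; have [js sE] := xi_sum W WU s.
  rewrite {1}sE {2}sE scaler_sumr !(morphD_sum (xiD W WU j)) mulr_sumr.
  apply: eq_bigr => i _; rewrite scalerA !xiE //.
  by case: eqP => // _; rewrite mulr0.
- move=> W W' WU W'W s; have [js sE] := xi_sum W WU s.
  have W'U : W' `<=` U by exact: subset_trans WU.
  have rD : {morph @rres M A W W' : a b / a + b}.
    by move=> a b; exact: (gs_resD (rsheaf A)).
  rewrite {1}sE {2}sE (morphD_sum (mresD W'W)) !(morphD_sum (xiD _ _ j)) //.
  rewrite (morphD_sum rD); apply: eq_bigr => i _.
  rewrite mresZ // mres_comp // !xiE //.
  by case: eqP => // _; rewrite (morphD_0 rD).
Qed.

(** Locally [a] is a combination of monomials in coordinates of positive degree with coefficients of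
    degree 0. Every term has degree at least 0, so the component of degree [k < 0] vanishes. *)
Lemma Nmanifold_negative_degree (R : realType) (N : Nmanifold R) (U : opn N)
    (k : int) (a : fsheaf N U) : k < 0 -> rdeg k a -> a = 0.
Proof.
move=> k0 ak; apply: (gs_separated (rsheaf (fsheaf N))) => x Ux.
have [U0 [xi [U0x [xi_deg /(_ (opnI U U0))]]]] := local_coordinates x.
have VU : opnI U U0 `<=` U by move=> y [].
have VU0 : opnI U U0 `<=` U0 by move=> y [].
move=> /(_ VU0)[gen _]; exists (opnI U U0); split=> //.
set V := opnI U U0 in VU VU0 gen *.
have := gs_deg_res (rsheaf (fsheaf N)) VU ak.
move: (rres V a) => {ak}a ak; rewrite -(hcomp_id (rsheaf (fsheaf N)) ak).
have [ws [g [_ ->]]] := gen a.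
rewrite (morphD_sum (@hcompD _ _ _ _ _ _ _)) big1 // => w _.
have [d dE] : exists d : nat, rdeg d%:Z (\prod_(y <- w) rres V (xi y)).
  elim: w => [|y w [d IH]]; first by exists 0%N; rewrite big_nil; exact: rdeg1.
  exists (coord_deg y + d)%N; rewrite big_cons PoszD; apply: rdegM => //.
  exact: (gs_deg_res (rsheaf (fsheaf N)) VU0).
have gdeg := rmap_deg (proj_pb N) (Csheaf_deg0 (g w)).
rewrite (hcompE _ k (rdegM gdeg dE)) add0r.
by case: eqP => // kd; move: k0; rewrite kd.
Qed.

(** * Natural bundle maps over the zero embedding and fibre-linear functions *)

Section NaturalMaps.
Variables (M : topologicalType) (O A : ring_sheaf M).
Variables (pi : ring_sheaf_map O A) (zero : ring_sheaf_map A O).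
Hypothesis zeroK : forall U g, zero U (pi U g) = g.
Variables (E : module_sheaf O) (PE : module_sheaf A).
Variable eta : semilinear_map pi E PE.
Hypothesis hPE : is_pullback eta.
Variable zPE : semilinear_map zero PE E.
Hypothesis zPEK : forall U e, zPE U (eta U e) = e.

(** The point is that replacing [s] by [eta (zPE s)] is invisible after [zero]. This holds on
    generators [eta x] by [zPEK], and it passes to multiples because [zeroK] gives
    [zero (pi (zero a)) = zero a]. *)
Lemma natural_map_pullback_ex (V : opn M) (xi : forall W, PE W -> A W) :
  fibre_linear V xi ->
  natural_map_pullback zPE V xi (fun W e => zero W (xi W (eta W e))).
Proof.
move=> [xiD xiZ xi_res]; split.
  split=> [W WV s t|W WV a s|W W' WV W'W s].
  - by rewrite smapD xiD // rmapD.
  - by rewrite smapZ xiZ // rmapM zeroK.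
  - by rewrite smap_res // xi_res // rmap_res.
(* The inclusion in [V] is made part of the property, since [xi] is linear only there. *)
move=> W WV s; move: W s WV; apply: (pullback_ind hPE (Q := fun W s => W `<=` V ->
  zero W (xi W (eta W (zPE W s))) = zero W (xi W s))).
- move=> W s ls WV; apply: subr0_eq; apply: (gs_separated (rsheaf O)).
  apply: locally_imp ls => W' W'W sE.
  have rD : {morph @rres M O W W' : a b / a + b}.
    by move=> a b; exact: (gs_resD (rsheaf O)).
  rewrite (morphD_B rD) -!rmap_res // -!xi_res // -!smap_res //.
  by rewrite sE ?subrr //; exact: subset_trans WV.
- move=> W WV; rewrite (morphD_0 (smapD zPE (U := W))).
  by rewrite (morphD_0 (smapD eta (U := W))).
- by move=> W s t sE tE WV; rewrite !smapD !xiD // !rmapD sE // tE.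
- by move=> W a s sE WV; rewrite !smapZ !xiZ // !rmapM zeroK sE.
- by move=> W x WV; rewrite zPEK.
Qed.

Variables (P : module_sheaf A) (zP : semilinear_map zero P E).
Variable Theta : linear_map P PE.
Hypothesis Theta_iso : is_isomorphism Theta.

Lemma eq_natural_maps_induced rk :
  (forall x : M, exists (U : opn M) (e : frame_label rk -> P U),
     oset U x /\ is_frame e) ->
  eq_natural_maps zP zPE Theta <-> is_induced_map zP zPE Theta (linear_id E).
Proof.
move=> frames; split=> [eqn U s|ind V xi xi_lin lambda]; last first.
  split=> -[lin lambdaE]; split=> // W WV s; last first.
    by rewrite -lambdaE // -(ind W s).
  have [G [_ GK]] := isomorphism_inverse Theta_iso.
  by rewrite -[s]GK -(ind W (G W s)) /= lambdaE.
apply: subr0_eq; apply: (gs_separated (msheaf E)) => x Ux.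
have [U0 [e [U0x fr]]] := frames x.
have VU : opnI U U0 `<=` U by move=> y [].
have VU0 : opnI U U0 `<=` U0 by move=> y [].
exists (opnI U U0); split=> //; set V := opnI U U0 in VU VU0 *.
rewrite (morphD_B (@mresD _ _ E _ _ VU)) -!smap_res //=.
move: (mres V s) => {}s; set d := _ - _.
have [xi [xi_lin xi_sum]] := frame_coordinates (is_frame_isomorphism Theta_iso fr).
(* The function [e |-> zero (xi j (eta e))] pulls [xi j] back along the natural map of [PE], hence
   by assumption [xi j \o Theta] along that of [P]. It thus takes the value [zero (xi j (Theta s))]
   on both terms of [d]. *)
have xi_d j : zero V (xi j V (eta V d)) = 0.
  have nat := natural_map_pullback_ex (xi_lin j).
  have [[lamD _ _] lamE] := nat.
  have [_ lamE'] := (eqn _ _ (xi_lin j) _).2 nat.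
  by rewrite (morphD_B (lamD V VU0)) lamE' // lamE // subrr.
have [js dE] := xi_sum V VU0 (eta V d).
rewrite -[d]zPEK dE (morphD_sum (smapD zPE (U := V))) big1 // => j _.
by rewrite smapZ xi_d scale0r.
Qed.

End NaturalMaps.

(** * Equivalence of the three conditions on [Theta] *)

Theorem theorem2p2 (R : realType) (N : Nmanifold R)
    (B : vector_bundle N) (hB : degree_bounded B)
    (* E = 0^* B, with pullback of sections zB *)
    (E : module_sheaf (body_sheaf N)) (zB : semilinear_map (zero_pb N) B E)
    (hE : is_pullback zB)
    (* PE = pi^* E, with pullback of sections eta *)
    (PE : module_sheaf (fsheaf N)) (eta : semilinear_map (proj_pb N) E PE)
    (hPE : is_pullback eta)
    (* the canonical identification 0^* pi^* E = E *)
    (zPE : semilinear_map (zero_pb N) PE E)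
    (hzPE : forall U (e : E U), zPE U (eta U e) = e)
    (Theta : linear_map B PE) (hTheta : is_isomorphism Theta) :
  (filtration_preserving zB eta zPE Theta <-> eq_natural_maps zB zPE Theta) /\
  (filtration_preserving zB eta zPE Theta <->
   is_induced_map zB zPE Theta (linear_id E)).
Proof.
have induced_eq := eq_natural_maps_induced (@zero_pbK _ N) hPE hzPE zB hTheta
  (@locally_free _ _ B).
suff fp_ind : filtration_preserving zB eta zPE Theta <->
    is_induced_map zB zPE Theta (linear_id E).
  by split=> //; rewrite induced_eq.
split=> [fp U s|ind i].
  have [r ->] := hcomp_sum (msheaf B) s.
  rewrite !(morphD_sum (smapD _ (U := U))) /=; apply: eq_bigr => k _.
  have dk := hcomp_deg (msheaf B) k s.
  have [_ [sigma [sigma' [hs hs' eqs]]]] := fp k.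
  (* [zPE] is a left inverse of [eta], so the equality of classes in the graded piece of degree [k]
     descends to [E]. *)
  rewrite -[LHS](hzPE U) -(gp_class hs dk) -eqs; last exact: filtration_gen dk.
  by rewrite (gp_class hs' (smap_deg Theta dk)) hzPE.
have [G [TK GK]] := isomorphism_inverse hTheta.
have fE := filtration_isomorphism hTheta.
split=> [U|].
  apply/seteqP; split=> [_ [s Fs <-]|s Fs]; first exact/fE.
  by exists (G U s); [apply/fE; rewrite GK | exact: GK].
have [sigma hs] := pullback_graded_piece (@Csheaf_deg0 _ _ _ (body_sheaf N))
  (@Nmanifold_negative_degree _ N) (@proj_pb_deg0 _ N) (@zero_pb_pos _ N)
  (@zero_pbK _ N) hPE hzPE i.
(* The identification for [B] is transported from [PE] along [Theta], so compatibility is immediate.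
   The hypothesis [ind] enters only in the last property, the value on classes of degree [i]
   sections. *)
exists (fun U s => sigma U (Theta U s)), sigma; split=> //; split.
- move=> U s t /fE Fs /fE Ft; rewrite smapD; exact: (gp_add hs).
- move=> U a s /fE Fs; rewrite smapZ; exact: (gp_scale hs).
- move=> U V VU s /fE Fs; rewrite smap_res //; exact: (gp_res hs).
- move=> U s /fE Fs; exact: (gp_codomain hs).
- by move=> U s /fE Fs; rewrite (gp_kernel hs Fs) fE.
- move=> U q /(gp_surj hs); apply: locally_imp => V VU [s Fs sq].
  by exists (G V s); [apply/fE; rewrite GK | rewrite GK].
- by move=> U b bi; rewrite (gp_class hs (smap_deg Theta bi)) -(ind U b).
Qed.
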